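(* Let $\Gamma = (\mathcal{V}, \mathcal{E})$ be a non-empty connected undirected graph and let $\mathcal{G}(\Gamma) = \big(\Gamma,\ G_{v}\ (v \in \mathcal{V}),\ H_{e},\ \varphi_{\pm e}\ (e \in \mathcal{E})\big)$ be a graph of groups over $\Gamma$. If $\Gamma$ is a tree, then $\pi_{1}(\mathcal{G}(\Gamma))$ can be embedded in the HNN-extension $$\mathbb{E} = \big\langle G_{v}\ (v \in \mathcal{V}),\ t_{e}\ (e \in \mathcal{E});\ t_{e}^{-1}(h\varphi_{+e})t_{e} = h\varphi_{-e}\ (e \in \mathcal{E},\ h \in H_{e}) \big\rangle.$$
   Context: Maps of groups are written on the right. A (directed) graph of groups $\mathcal{G}(\Gamma)$ over $\Gamma$ assigns to each vertex $v \in \mathcal{V}$ a group $G_v$, and to each edge $e \in \mathcal{E}$ a direction (i.e. a labelling of its ends as $e(1)$ and $e(-1)$), a group $H_e$, and injective homomorphisms $\varphi_{+e}\colon H_e \to G_{e(1)}$, $\varphi_{-e}\colon H_e \to G_{e(-1)}$. When $\Gamma$ is a tree, the fundamental group $\pi_1(\mathcal{G}(\Gamma))$ (the tree product of the groups $G_v$) is the group generated by the generators of the groups $G_v$ ($v \in \mathcal{V}$), with defining relations those of the $G_v$ together with $h\varphi_{+e} = h\varphi_{-e}$ ($e \in \mathcal{E}$, $h \in H_e$). The presentation of $\mathbb{E}$ means: the generators of $\mathbb{E}$ are the generators of all $G_v$ together with symbols $t_e$ ($e \in \mathcal{E}$), and the defining relations are those of all $G_v$ together with the displayed ones. Thus $\mathbb{E}$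 is the HNN-extension, with stable letters $t_e$ ($e \in \mathcal{E}$), whose base group is the ordinary free product of the groups $G_v$ ($v \in \mathcal{V}$). *)

(* Defs.v *)
From HB Require Import structures.
From mathcomp Require Import all_boot.
From mathcomp Require Import boolp.

Set Implicit Arguments.
Unset Strict Implicit.
Unset Printing Implicit Defensive.

Local Open Scope group_scope.
Local Open Scope quotient_scope.

(* Group words over X: (x, true) is the generator x, (x, false) is x^-1.
   {classic X} is X itself with classical equality and choice operators. *)
Definition word (X : Type) := seq ({classic X} * bool).

Definition pgen (X : Type) (x : X) : {classic X} * bool := (x, true).
Definition ngen (X : Type) (x : X) : {classic X} * bool := (x, false).

Definition word_inv (X : Type) (w : word X) : word X :=
  rev [seq (a.1, ~~ a.2) | a <- w].

Section Presentation.

(* The group < X ; u = v (R u v) >: words modulo the least congruence that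
   contains R and free cancellation. *)
Variables (X : Type) (R : word X -> word X -> Prop).

Inductive pres_congr : word X -> word X -> Prop :=
| pres_rel u v : R u v -> pres_congr u v
| pres_cancel x b : pres_congr [:: (x, b); (x, ~~ b)] [::]
| pres_refl u : pres_congr u u
| pres_sym u v : pres_congr u v -> pres_congr v u
| pres_trans u v w : pres_congr u v -> pres_congr v w -> pres_congr u w
| pres_cat u u' v v' :
    pres_congr u u' -> pres_congr v v' -> pres_congr (u ++ v) (u' ++ v').

Definition pres_congrb (u v : word X) : bool := `[< pres_congr u v >].

Lemma pres_congrb_equiv : equiv_class_of pres_congrb.
Proof.
split=> [u|u v|v u w].
- exact/asboolP/pres_refl.
- by apply/asboolP/asboolP; apply: pres_sym.
- by move=> /asboolP uv /asboolP vw; apply/asboolP/pres_trans/vw.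
Qed.

Canonical pres_congr_equiv := EquivRelPack pres_congrb_equiv.

Definition presented := {eq_quot pres_congr_equiv}.
HB.instance Definition _ := Choice.on presented.
HB.instance Definition _ := EqQuotient.on presented.

Definition pres_one : presented := \pi_presented [::].
Definition pres_mul (a b : presented) : presented :=
  \pi_presented (repr a ++ repr b).
Definition pres_inv (a : presented) : presented :=
  \pi_presented (word_inv (repr a)).

Lemma pres_piP (u v : word X) :
  \pi_presented u = \pi_presented v <-> pres_congr u v.
Proof. by split=> [/eqquotP/asboolP|?]; last exact/eqquotP/asboolP. Qed.

Lemma pres_mul_pi (u v : word X) :
  pres_mul (\pi_presented u) (\pi_presented v) = \pi_presented (u ++ v).
Proof. by apply/pres_piP/pres_cat; apply/pres_piP; rewrite reprK. Qed.

Lemma word_inv_cons (a : {classic X} * bool) (u : word X) :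
  word_inv (a :: u) = word_inv u ++ [:: (a.1, ~~ a.2)].
Proof. by rewrite /word_inv /= rev_cons -cats1. Qed.

Lemma word_invK : involutive (@word_inv X).
Proof.
move=> u; rewrite /word_inv map_rev revK -map_comp map_id_in //.
by case=> x b _; rewrite /= negbK.
Qed.

Lemma pres_congr_mulV (u : word X) : pres_congr (u ++ word_inv u) [::].
Proof.
elim: u => [|[x b] u IHu]; first exact: pres_refl.
rewrite word_inv_cons; apply: pres_trans (pres_cancel x b).
have := pres_cat (pres_refl [:: (x, b)]) (pres_cat IHu (pres_refl [:: (x, ~~ b)])).
by rewrite /= -catA.
Qed.

Lemma pres_congr_mulVw (u : word X) : pres_congr (word_inv u ++ u) [::].
Proof. by rewrite -{2}[u]word_invK; apply: pres_congr_mulV. Qed.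

Fact pres_mulA : associative pres_mul.
Proof.
elim/quotW=> u; elim/quotW=> v; elim/quotW=> w.
by rewrite (pres_mul_pi v w) (pres_mul_pi u v) !(pres_mul_pi _ _) catA.
Qed.

Fact pres_mul1 : left_id pres_one pres_mul.
Proof. by elim/quotW=> u; rewrite (pres_mul_pi [::] u). Qed.

Fact pres_mulr1 : right_id pres_one pres_mul.
Proof. by elim/quotW=> u; rewrite (pres_mul_pi u [::]) cats0. Qed.

Fact pres_mulV : left_inverse pres_one pres_inv pres_mul.
Proof.
move=> a; rewrite -[X in pres_mul _ X]reprK (pres_mul_pi (word_inv (repr a))).
exact/pres_piP/pres_congr_mulVw.
Qed.

Fact pres_mulrV : right_inverse pres_one pres_inv pres_mul.
Proof.
move=> a; rewrite -[X in pres_mul X _]reprK (pres_mul_pi (repr a)).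
exact/pres_piP/pres_congr_mulV.
Qed.

HB.instance Definition _ := isGroup.Build presented
  pres_mulA pres_mul1 pres_mulr1 pres_mulV pres_mulrV.

End Presentation.

(* Undirected graphs, possibly infinite, with loops and multiple edges. *)
Definition joins_of (V E : Type) (inc : E -> V -> Prop) (e : E) (x y : V) :=
  forall v, inc e v <-> v = x \/ v = y.

Record ugraph := UGraph {
  vertex : Type;
  edge : Type;
  incident : edge -> vertex -> Prop;
  incident_ends : forall e, exists x y, joins_of incident e x y
}.

Section Trees.

Variable Gam : ugraph.

Definition joins : edge Gam -> vertex Gam -> vertex Gam -> Prop :=
  joins_of (@incident Gam).

(* A walk from x is the sequence of pairs (edge, vertex reached by it). *)
Fixpoint walk (x : vertex Gam) (s : seq (edge Gam * vertex Gam))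
    (y : vertex Gam) : Prop :=
  if s is (e, z) :: s' then joins e x z /\ walk z s' y else x = y.

Definition graph_nonempty : Prop := inhabited (vertex Gam).

Definition graph_connected : Prop := forall x y, exists s, walk x s y.

(* Distinctness of the edges excludes backtracking along a single edge, so
   that loops and pairs of parallel edges are cycles but [:: e; e] is not. *)
Definition is_cycle (x : vertex Gam) (s : seq (edge Gam * vertex Gam)) : Prop :=
  [/\ s <> [::], walk x s x,
      uniq ([seq p.1 | p <- s] : seq {classic (edge Gam)}) &
      uniq ([seq p.2 | p <- s] : seq {classic (vertex Gam)})].

Definition is_tree : Prop :=
  [/\ graph_nonempty, graph_connected & forall x s, ~ is_cycle x s].

End Trees.

(* end_pos e, end_neg e are the ends e(1), e(-1) given by the direction of e;
   emb_pos e, emb_neg e are the monomorphisms phi_{+e}, phi_{-e}. *)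
Record graph_of_groups (Gam : ugraph) := GraphOfGroups {
  vgroup : vertex Gam -> groupType;
  end_pos : edge Gam -> vertex Gam;
  end_neg : edge Gam -> vertex Gam;
  endsP : forall e, joins e (end_pos e) (end_neg e);
  egroup : edge Gam -> groupType;
  emb_pos : forall e, {multiplicative egroup e -> vgroup (end_pos e)};
  emb_neg : forall e, {multiplicative egroup e -> vgroup (end_neg e)};
  emb_pos_inj : forall e, injective (emb_pos e);
  emb_neg_inj : forall e, injective (emb_neg e)
}.

Section Groups.

Variables (Gam : ugraph) (GG : graph_of_groups Gam).

(* Each G_v is presented by all its elements and its multiplication table. *)
Definition velt : Type := {v : vertex Gam & vgroup GG v}.

Definition vin (v : vertex Gam) (g : vgroup GG v) : velt :=
  existT (fun v => vgroup GG v : Type) v g.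

Inductive tree_product_rel : word velt -> word velt -> Prop :=
| tp_vertex (v : vertex Gam) (g h : vgroup GG v) :
    tree_product_rel [:: pgen (vin g); pgen (vin h)] [:: pgen (vin (g * h))]
| tp_edge (e : edge Gam) (h : egroup GG e) :
    tree_product_rel [:: pgen (vin (emb_pos GG e h))]
                     [:: pgen (vin (emb_neg GG e h))].

(* The fundamental group pi_1 of GG when Gam is a tree. *)
Definition tree_product : groupType := presented tree_product_rel.

Definition hnn_gen : Type := (velt + edge Gam)%type.

Definition hnn_v (v : vertex Gam) (g : vgroup GG v) : hnn_gen := inl (vin g).
Definition hnn_t (e : edge Gam) : hnn_gen := inr e.

Inductive hnn_rel : word hnn_gen -> word hnn_gen -> Prop :=
| hnn_vertex (v : vertex Gam) (g h : vgroup GG v) :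
    hnn_rel [:: pgen (hnn_v g); pgen (hnn_v h)] [:: pgen (hnn_v (g * h))]
| hnn_edge (e : edge Gam) (h : egroup GG e) :
    hnn_rel [:: ngen (hnn_t e); pgen (hnn_v (emb_pos GG e h)); pgen (hnn_t e)]
            [:: pgen (hnn_v (emb_neg GG e h))].

Definition hnn_extension : groupType := presented hnn_rel.

End Groups.

(* Main.v *)
Require Import Defs.
From HB Require Import structures.
From mathcomp Require Import all_boot.
From mathcomp Require Import boolp.
From mathcomp Require Import zify.

(** The tree product is a retract of the HNN-extension.  Sending every stable
    letter to 1 and every G_v identically into the tree product respects the
    relations of the HNN-extension, because they become the edge relations
    h phi_{+e} = h phi_{-e}.  This gives a homomorphism r from the
    HNN-extension to the tree product, and it is enough to find a section of r.

    The inclusions of the G_v in the HNN-extension do not agree on the edge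
    groups: those of the two ends of e differ by conjugation by t_e.  On a tree
    these conjugations can be undone coherently.  Let q_v be the product of the
    letters t_e^{+1}, t_e^{-1} read along a walk from v to a root.  A closed walk
    in a tree has product 1 ([closed_walk_prod]), so q_v does not depend on the
    walk, and q_{e(1)} = t_e q_{e(-1)} ([tree_potential]).  Therefore g |-> g ^ q_v
    on G_v respects the edge relations and defines a homomorphism f from the
    tree product.

    Since r kills the t_e, the elements r(q_v) take the same value at the two
    ends of every edge; they are 1 at the root, hence everywhere.  So r o f
    fixes every G_v, r o f = id, and f is injective. *)

Set Implicit Arguments.
Unset Strict Implicit.
Unset Printing Implicit Defensive.

Local Open Scope group_scope.
Local Open Scope quotient_scope.

(** * Homomorphisms out of a presented group *)

Section PresentedMorphisms.

Variables (X : Type) (R : word X -> word X -> Prop) (G : groupType).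

Lemma pi_cat (u v : word X) :
  \pi_(presented R) (u ++ v) = \pi_(presented R) u * \pi_(presented R) v.
Proof. exact: esym (pres_mul_pi R u v). Qed.

Definition word_eval (phi : X -> G) (w : word X) : G :=
  \prod_(a <- w) (if a.2 then phi a.1 else (phi a.1)^-1).

Lemma word_eval_congr (phi : X -> G) :
    (forall u v, R u v -> word_eval phi u = word_eval phi v) ->
  forall u v, pres_congr R u v -> word_eval phi u = word_eval phi v.
Proof.
move=> phiR u v; elim=> {u v} [u v /phiR //|x b|//|u v _ ->//||].
- rewrite /word_eval !big_cons !big_nil mulg1.
  by case: b; rewrite ?mulgV ?mulVg.
- by move=> u v w _ -> _ ->.
- by move=> u u' v v' _ equ _ eqv; move: equ eqv;
    rewrite /word_eval !big_cat => -> ->.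
Qed.

(** Von Dyck's theorem.  The lift evaluates a chosen representative word.  It is
    given as a unital morphism, from which compatibility with inverses, and so
    with conjugation, follows. *)
Lemma presented_lift (phi : X -> G) :
    (forall u v, R u v -> word_eval phi u = word_eval phi v) ->
  exists f : UMagmaMorphism.type (presented R) G,
    forall x, f (\pi_(presented R) [:: pgen x]) = phi x.
Proof.
move=> phiR; have evalE := word_eval_congr phiR.
pose F (a : presented R) := word_eval phi (repr a).
have F_pi u : F (\pi_(presented R) u) = word_eval phi u.
  by apply/evalE/(pres_piP R); rewrite reprK.
have FM : {morph F : a b / a * b}.
  by move=> a b; rewrite [a * b]/(pres_mul a b) F_pi /word_eval big_cat.
have F1 : F 1 = 1 by rewrite [F 1]F_pi /word_eval big_nil.
pose mF := isMultiplicative.Build _ _ F FM.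
pose uF := Multiplicative_isUMagmaMorphism.Build _ _ F F1.
pose f : UMagmaMorphism.type (presented R) G := HB.pack F mF uF.
by exists f => x; rewrite [f _]F_pi /word_eval big_seq1.
Qed.

Lemma presented_eq_morph (f g : UMagmaMorphism.type (presented R) G) :
    (forall x, f (\pi_(presented R) [:: pgen x]) =
               g (\pi_(presented R) [:: pgen x])) ->
  f =1 g.
Proof.
move=> fg; elim/quotW; elim=> [|[x b] w IHw].
  by rewrite -[\pi _]/(1 : presented R) !gmulf1.
rewrite -[(x, b) :: w]/([:: (x, b)] ++ w) pi_cat !gmulfM IHw; congr (_ * _).
case: b; first exact: fg.
have -> : \pi_(presented R) [:: (x, false)] = (\pi_(presented R) [:: pgen x])^-1.
  apply/esym/mulg1_eq; rewrite -pi_cat.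
  exact/(pres_piP R)/(pres_cancel R x true).
by rewrite !gmulfV fg.
Qed.

End PresentedMorphisms.

(** * Potentials on trees *)

Section NonUniq.

Variables (S : Type) (T : eqType) (f : S -> T).

Lemma mem_map_split x s :
  x \in map f s -> exists s1 a s2, s = s1 ++ a :: s2 /\ f a = x.
Proof.
elim: s => //= a s IHs; rewrite inE => /predU1P[->|/IHs].
  by exists [::], a, s.
by case=> s1 [b [s2 [-> fb]]]; exists (a :: s1), b, s2.
Qed.

Lemma not_uniq_map_split s : ~~ uniq (map f s) ->
  exists s1 a s2 b s3, s = s1 ++ a :: s2 ++ b :: s3 /\ f a = f b.
Proof.
elim: s => //= a s IHs; rewrite negb_and negbK => /orP[/mem_map_split|/IHs].
  by case=> s2 [b [s3 [-> fb]]]; exists [::], a, s2, b, s3.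
by case=> s1 [b [s2 [c [s3 [-> fbc]]]]]; exists (a :: s1), b, s2, c, s3.
Qed.

End NonUniq.

Section Walks.

Variable Gam : ugraph.
Implicit Types (x y z : vertex Gam) (s : seq (edge Gam * vertex Gam)).

Lemma joins_ends (e : edge Gam) x y a b :
  joins e x y -> joins e a b -> (x = a /\ y = b) \/ (x = b /\ y = a).
Proof.
move=> xy ab.
have /(ab x) : incident e x by apply/xy; left.
have /(ab y) : incident e y by apply/xy; right.
have /(xy a) : incident e a by apply/ab; left.
have /(xy b) : incident e b by apply/ab; right.
by do 4![case=> ?]; subst; auto.
Qed.

Lemma walk_cat x s1 s2 y :
  walk x (s1 ++ s2) y <-> exists2 z, walk x s1 z & walk z s2 y.
Proof.
elim: s1 x => [|[e z] s1 IHs] x /=.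
  by split=> [|[_ <-]] //; exists x.
split=> [[xz /IHs[w ? ?]]|[w [xz zw] wy]]; first by exists w.
by split=> //; apply/IHs; exists w.
Qed.

Lemma walk_rcons x s p y : walk x (rcons s p) y -> y = p.2.
Proof. by rewrite -cats1 => /walk_cat[z _]; case: p => e w [_ /= ->]. Qed.

Variables (src tgt : edge Gam -> vertex Gam) (G : groupType) (d : edge Gam -> G).

(** The factor d e is inverted when e is crossed from tgt e to src e.  On a loop,
    where the direction of crossing is ambiguous, it is never inverted. *)
Definition step_label (x : vertex Gam) (e : edge Gam) : G :=
  if `[< x = src e >] then d e else (d e)^-1.

Fixpoint walk_prod (x : vertex Gam) (s : seq (edge Gam * vertex Gam)) : G :=
  if s is (e, z) :: s' then step_label x e * walk_prod z s' else 1.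

Lemma walk_prod_cat x s1 s2 z : walk x s1 z ->
  walk_prod x (s1 ++ s2) = walk_prod x s1 * walk_prod z s2.
Proof.
elim: s1 x => [|[e y] s1 IHs] x /= => [->|[_ /IHs->]]; first by rewrite mul1g.
by rewrite mulgA.
Qed.

Hypothesis srctgt : forall e, joins e (src e) (tgt e).

Lemma step_label_rev x y e : joins e x y -> x <> y ->
  step_label x e * step_label y e = 1.
Proof.
move=> exy; rewrite /step_label.
case: (joins_ends exy (srctgt e)) => -[-> ->] neq.
  by rewrite asboolT // asboolF ?mulgV //; apply: nesym.
by rewrite asboolF // asboolT // mulVg.
Qed.

Hypothesis acyclic : forall x s, ~ is_cycle x s.

(** An edge traversed twice by a closed walk without repeated vertices must be
    traversed back and forth, and there is then room for nothing else. *)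
Lemma closed_walk_edge_twice x s : walk x s x ->
    uniq ([seq p.2 | p <- s] : seq {classic (vertex Gam)}) ->
    ~~ uniq ([seq p.1 | p <- s] : seq {classic (edge Gam)}) ->
  exists e y, [/\ s = [:: (e, y); (e, x)], joins e x y & x <> y].
Proof.
move=> wx us /(not_uniq_map_split (T := {classic (edge Gam)})).
case=> s1 [[e y] [s2 [[e' z] [s3 [def_s /= eq_e]]]]].
move: eq_e def_s => <- {e'} def_s; move: wx us; rewrite {}def_s.
case/walk_cat=> u w1 /= [uy] /walk_cat[w w2 /= [wz w3]] us.
(* The two passages go from u to y and, later, from w to z. *)
have yz : y <> z.
  move=> eq_yz; move: us; rewrite map_cat cat_uniq /= map_cat mem_cat /= eq_yz.
  by rewrite inE eqxx orbT /= !andbF.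
have [[_ /yz//]|[eq_uz eq_yw]] := joins_ends uy wz; subst z w.
have s1_nil : s1 = [::].
  (* A nonempty s1 ends at u, which is reached again by the second passage. *)
  case/lastP: s1 => // s1 p in w1 us *.
  move: us; rewrite (walk_rcons w1) map_cat cat_uniq => /and3P[_ /hasPn/(_ p.2)].
  rewrite map_rcons mem_rcons mem_head /= map_cat inE mem_cat /= mem_head !orbT.
  by move=> /(_ isT).
subst s1; rewrite /= in w1; subst u.
(* Now u = x.  A nonempty s2 would return to y, a nonempty s3 to x. *)
have s2_nil : s2 = [::].
  case/lastP: s2 => // s2 p in w2 us *.
  move: us; rewrite /= map_cat map_rcons mem_cat mem_rcons inE.
  by rewrite (walk_rcons w2) eqxx.
have s3_nil : s3 = [::].
  case/lastP: s3 => // s3 p in w3 us *.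
  move: us; rewrite /= map_cat cat_uniq /= map_rcons mem_rcons inE.
  by rewrite -(walk_rcons w3) eqxx /= !andbF.
by subst s2 s3; exists e, y; split=> //; apply: nesym.
Qed.

(** A repeated vertex cuts the walk into two shorter closed walks; otherwise
    acyclicity forces an edge to be repeated. *)
Lemma closed_walk_prod x s : walk x s x -> walk_prod x s = 1.
Proof.
have [n le_sn] := ubnP (size s); elim: n => // n IHn in x s le_sn *.
move=> wx; case us: (uniq ([seq p.2 | p <- s] : seq {classic (vertex Gam)})).
  case ue: (uniq ([seq p.1 | p <- s] : seq {classic (edge Gam)})).
    case: s => [//|p s] in wx us ue le_sn *.
    by have [] := @acyclic x (p :: s).
  have [e [y [-> exy xy]]] := closed_walk_edge_twice wx us (negbT ue).
  by rewrite /= mulg1 step_label_rev.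
have [s1 [[e y] [s2 [[e' z] [s3 [def_s /= eq_yz]]]]]] :=
  not_uniq_map_split (T := {classic (vertex Gam)}) (negbT us).
move: eq_yz def_s => <- {z us}.
rewrite -cat_rcons -(cat_rcons (e', y)) => def_s; subst s.
have [y1 w1 /walk_cat[y2 w2 w3]] := (walk_cat _ _ _ _).1 wx.
have [ey1 ey2] := (walk_rcons w1, walk_rcons w2); rewrite /= in ey1 ey2; subst y1 y2.
move: le_sn; rewrite !size_cat !size_rcons => le_sn.
rewrite (walk_prod_cat _ w1) (walk_prod_cat _ w2).
rewrite (IHn y (rcons s2 _)) ?mul1g ?size_rcons; [|lia|by []].
rewrite -(walk_prod_cat _ w1) IHn ?size_cat ?size_rcons; [by []|lia|].
by apply/walk_cat; exists y.
Qed.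

(** Closing up both walks by the same return walk gives two closed walks, both of
    product 1. *)
Lemma walk_prod_unique x y s s' : graph_connected Gam ->
  walk x s y -> walk x s' y -> walk_prod x s = walk_prod x s'.
Proof.
move=> /(_ y x)[r wr] ws ws'; apply: (mulIg (walk_prod y r)).
rewrite -(walk_prod_cat _ ws) -(walk_prod_cat _ ws').
by rewrite !closed_walk_prod //; apply/walk_cat; exists y.
Qed.

(** q x is the product along a walk from x to the root: a walk from tgt e
    becomes one from src e by crossing e first. *)
Lemma tree_potential (root : vertex Gam) : graph_connected Gam ->
  exists2 q : vertex Gam -> G,
    q root = 1 & forall e, q (src e) = d e * q (tgt e).
Proof.
move=> conn; have [s ws] := choice (fun x => conn x root).
exists (fun x => walk_prod x (s x)); first exact: closed_walk_prod.
move=> e; have we : walk (src e) ((e, tgt e) :: s (tgt e)) root by split.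
by rewrite (walk_prod_unique conn (ws _) we) /= /step_label asboolT.
Qed.

End Walks.

Lemma walk_constant (Gam : ugraph) (src tgt : edge Gam -> vertex Gam)
    (T : Type) (q : vertex Gam -> T) :
    (forall e, joins e (src e) (tgt e)) -> (forall e, q (src e) = q (tgt e)) ->
  forall x s y, walk x s y -> q x = q y.
Proof.
move=> st qe x s y; elim: s x => [|[e z] s IHs] x /= => [->//|[exz /IHs <-]].
by case: (joins_ends exz (st e)) => -[-> ->].
Qed.

(** * The embedding *)

Section Embedding.

Variables (Gam : ugraph) (GG : graph_of_groups Gam).

Local Notation P := (tree_product GG).
Local Notation E := (hnn_extension GG).

Definition tree_product_in (v : vertex Gam) (g : vgroup GG v) : P :=
  \pi_(presented (@tree_product_rel Gam GG)) [:: pgen (vin g)].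
Definition hnn_in (v : vertex Gam) (g : vgroup GG v) : E :=
  \pi_(presented (@hnn_rel Gam GG)) [:: pgen (hnn_v g)].
Definition stable_letter (e : edge Gam) : E :=
  \pi_(presented (@hnn_rel Gam GG)) [:: pgen (hnn_t GG e)].

Lemma tree_product_inM v (g h : vgroup GG v) :
  tree_product_in (g * h) = tree_product_in g * tree_product_in h.
Proof.
rewrite -[RHS]pi_cat.
exact/esym/pres_piP/pres_rel/tp_vertex.
Qed.

Lemma tree_product_in_edge e (h : egroup GG e) :
  tree_product_in (emb_pos GG e h) = tree_product_in (emb_neg GG e h).
Proof. exact/pres_piP/pres_rel/tp_edge. Qed.

Lemma hnn_inM v (g h : vgroup GG v) : hnn_in (g * h) = hnn_in g * hnn_in h.
Proof.
rewrite -[RHS]pi_cat.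
exact/esym/pres_piP/pres_rel/hnn_vertex.
Qed.

Lemma hnn_in_edge e (h : egroup GG e) :
  hnn_in (emb_neg GG e h) = hnn_in (emb_pos GG e h) ^ stable_letter e.
Proof.
apply: (mulgI (stable_letter e)); rewrite mulVKg.
rewrite -[LHS]pi_cat -[RHS]pi_cat.
apply/pres_piP; set t := hnn_t GG e; set x := hnn_v (emb_pos GG e h).
apply: (@pres_trans _ _ _ ([:: pgen t] ++ [:: ngen t; pgen x; pgen t])).
  exact: pres_cat (pres_refl _ [:: pgen t]) (pres_sym (pres_rel (hnn_edge h))).
exact: pres_cat (pres_cancel (@hnn_rel Gam GG) t true) (pres_refl _ [:: pgen x; pgen t]).
Qed.

(** When the stable letters become 1, the relations of the HNN-extension turn into
    those of the tree product. *)
Lemma hnn_retraction : exists r : UMagmaMorphism.type E P,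
  (forall v (g : vgroup GG v), r (hnn_in g) = tree_product_in g) /\
  (forall e, r (stable_letter e) = 1).
Proof.
pose phi (a : hnn_gen GG) : P :=
  match a with inl p => tree_product_in (projT2 p) | inr _ => 1 end.
have [|r rE] := @presented_lift _ (@hnn_rel Gam GG) P phi.
  move=> _ _ [v g h|e h]; rewrite /word_eval !big_cons !big_nil /= ?invg1 ?mulg1 ?mul1g.
    by rewrite tree_product_inM.
  exact: tree_product_in_edge.
by exists r; split=> [v g|e]; apply: rE.
Qed.

(** Conjugation by the q v identifies, for every e, the two copies of the edge
    group in the HNN-extension, which differ by conjugation by the stable
    letter. *)
Lemma twisted_lift (q : vertex Gam -> E) :
    (forall e, q (end_pos GG e) = stable_letter e * q (end_neg GG e)) ->
  exists f : UMagmaMorphism.type P E,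
    forall v (g : vgroup GG v), f (tree_product_in g) = hnn_in g ^ q v.
Proof.
move=> qE; pose phi (p : velt GG) : E := hnn_in (projT2 p) ^ q (projT1 p).
have [|f fE] := @presented_lift _ (@tree_product_rel Gam GG) E phi.
  move=> _ _ [v g h|e h]; rewrite /word_eval !big_cons !big_nil /= !mulg1 /phi /=.
    by rewrite hnn_inM conjMg.
  by rewrite hnn_in_edge qE conjgM.
by exists f => v g; apply: fE.
Qed.

End Embedding.

Theorem proposition2p4 (Gam : ugraph) (GG : graph_of_groups Gam)
    (Gam_nonempty : graph_nonempty Gam) (Gam_connected : graph_connected Gam) :
  is_tree Gam ->
  exists f : {multiplicative tree_product GG -> hnn_extension GG},
    injective f.
Proof.
case=> -[root] conn acyclic.
have [q q_root qE] :=
  tree_potential (@stable_letter _ GG) (endsP GG) acyclic root conn.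
have [f fE] := twisted_lift qE.
have [r [r_in r_t]] := hnn_retraction GG.
have rq v : r (q v) = 1.
  have [s ws] := conn v root.
  have -> : r (q v) = r (q root); last by rewrite q_root gmulf1.
  apply: (walk_constant (q := fun x => r (q x)) (endsP GG) _ ws) => e.
  by rewrite qE gmulfM r_t mul1g.
have rf : r \o f =1 idfun.
  apply: presented_eq_morph => -[v g] /=.
  by rewrite [f _](fE v g) gmulfJ rq conjg1 r_in.
by exists f; exact: (can_inj (g := r) rf).
Qed.
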